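(* Every strictly positive definite kernel $K:\mathbb{N}_0\times\mathbb{N}_0\to\mathbb{C}$ with $K(0,0)=1$ has a near tridiagonal model (as defined in the context).
   Context: $\mathbb{N}_0=\{0,1,2,\dots\}$. A kernel $K:\mathbb{N}_0\times\mathbb{N}_0\to\mathbb{C}$ is strictly positive definite if $\sum_{k,j=1}^nK(p_k,p_j)\lambda_j\overline{\lambda}_k>0$ for all $n>0$, distinct $p_1,\dots,p_n\in\mathbb{N}_0$ and $\lambda_1,\dots,\lambda_n\in\mathbb{C}$ not all zero; equivalently, every matrix $[K(i,j)]_{0\le i,j\le n}$, $n\ge 0$, is (Hermitian) positive definite. Let $e_0=[1\ 0\ 0\ \cdots]$ (row vector), so $e_0^*$ is the first standard basis vector of $l^2(\mathbb{N}_0)$, and let $\mathcal{D}\subset l^2(\mathbb{N}_0)$ be the linear span of the standard basis. A near tridiagonal model of $K$ is a family $\{J_n\}_{n\ge 1}$ of (not necessarily bounded) operators given by infinite matrices, rows and columns indexed by $\mathbb{N}_0$, of the form $$J_n=\begin{bmatrix} b_0(1) & c_{0,1}(n) & c_{0,2}(n) & \cdots\\ a_1(1) & b_1(2) & c_{1,2}(n) & \cdots\\ 0 & a_2(2) & b_2(3) & \ddots\\ & 0 & \ddots & \ddots\end{bmatrix},$$ that is, the $(k,k)$ entry is $b_k(k+1)$, the $(k,k-1)$ entry is $a_k(k)$ (these do not depend on $n$), the $(i,j)$ entry for $i<j$ is $c_{i,j}(n)$, and all entries $(i,j)$ with $i>j+1$ are $0$; where all entries are complex numbers satisfying - $a_k(k)>0$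 for $k\ge 1$; - $c_{i,j}(1)=0$ for $j\ge 2$, $0\le i<j-1$; - $c_{i,j}(n)=0$ for $j\ge n$, $0\le i<j-1$; - $c_{k-1,k}(n)=a_k(k)$ for $k\ge n$, $k\ge 1$; - $c_{i,j}(n)=c_{i,j}(n-1)$ for $j<n-1$, $0\le i\le j-1$; and such that $$K(i,j)=e_0J_1^*\cdots J_i^*\,J_j\cdots J_1e_0^*,\qquad i,j\ge 0.$$ Each $J_n$ maps $\mathcal{D}$ into $\mathcal{D}$, an empty product of $J$'s is the identity, and the right-hand side means the inner product $\langle J_j\cdots J_1e_0^*,\,J_i\cdots J_1e_0^*\rangle$ in $l^2(\mathbb{N}_0)$ (linear in the first variable). *)

(* Defs.v *)
From mathcomp Require Import all_boot all_order all_algebra.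
From mathcomp Require Import complex.
From mathcomp Require Import boolp classical_sets functions cardinality fsbigop.
From mathcomp Require Import reals.

Set Implicit Arguments.
Unset Strict Implicit.
Unset Printing Implicit Defensive.

Import Order.TTheory GRing.Theory Num.Theory.

Local Open Scope classical_set_scope.
Local Open Scope ring_scope.

(* On R[i] the order 0 < z means that z is real and positive, so the
   inequality below includes the realness of the quadratic form. *)
Definition strictly_positive_definite (R : realType) (K : nat -> nat -> R[i]) :
    Prop :=
  forall (n : nat) (p : 'I_n -> nat) (l : 'I_n -> R[i]),
    (0 < n)%N -> injective p -> (exists k, l k != 0) ->
    0 < \sum_(k < n) \sum_(j < n) K (p k) (p j) * l j * (l k)^*.

(* Vectors are sequences nat -> R[i]; the dense domain spanned by the standard
   basis of l^2 consists of the sequences satisfying finsupp.  The sums over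
   [set: nat] are finitely supported sums, with value 0 if the support is
   infinite.  This default is never used here: see near_tridiagonal_finsupp,
   orbit_finsupp and dotE. *)
Definition finsupp (R : realType) (u : nat -> R[i]) : Prop :=
  exists N, forall k, (N <= k)%N -> u k = 0.

Definition basis0 (R : realType) : nat -> R[i] := fun k => (k == 0%N)%:R.

Definition apply_mx (R : realType) (A : nat -> nat -> R[i]) (u : nat -> R[i]) :
    nat -> R[i] :=
  fun i => \sum_(j \in [set: nat]) A i j * u j.

Definition dot (R : realType) (u v : nat -> R[i]) : R[i] :=
  \sum_(k \in [set: nat]) u k * (v k)^*.

(* orbit J j = J_j ... J_1 e_0^*; the matrix J 0 is never used. *)
Fixpoint orbit (R : realType) (J : nat -> nat -> nat -> R[i]) (j : nat) :
    nat -> R[i] :=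
  if j is j'.+1 then apply_mx (J j) (orbit J j') else @basis0 R.

(* a k, b k and c n i j stand for a_k(k), b_k(k+1) and c_{i,j}(n). *)
Definition near_tridiagonal_mx (R : realType) (a b : nat -> R[i])
    (c : nat -> nat -> nat -> R[i]) (n i j : nat) : R[i] :=
  if (i < j)%N then c n i j
  else if i == j then b i
  else if i == j.+1 then a i
  else 0.

Record near_tridiagonal_coeffs (R : realType) (a : nat -> R[i])
    (c : nat -> nat -> nat -> R[i]) : Prop := NearTridiagonalCoeffs {
  coef_a_gt0 : forall k, (1 <= k)%N -> 0 < a k;
  coef_c_init : forall i j, (2 <= j)%N -> (i < j.-1)%N -> c 1%N i j = 0;
  coef_c_eq0 : forall n i j, (1 <= n)%N -> (n <= j)%N -> (i < j.-1)%N ->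
    c n i j = 0;
  coef_c_superdiag : forall n k, (1 <= n)%N -> (n <= k)%N -> (1 <= k)%N ->
    c n k.-1 k = a k;
  coef_c_stable : forall n i j, (1 <= n)%N -> (j < n.-1)%N -> (i < j)%N ->
    c n i j = c n.-1 i j
}.

Definition near_tridiagonal_family (R : realType)
    (J : nat -> nat -> nat -> R[i]) : Prop :=
  exists a b c, near_tridiagonal_coeffs a c /\
    forall n i j, (1 <= n)%N -> J n i j = near_tridiagonal_mx a b c n i j.

Definition near_tridiagonal_model (R : realType) (K : nat -> nat -> R[i])
    (J : nat -> nat -> nat -> R[i]) : Prop :=
  near_tridiagonal_family J /\
  forall i j, K i j = dot (orbit J j) (orbit J i).

Lemma fsumT_ord (V : nmodType) (F : nat -> V) (N : nat) :
  (forall k, (N <= k)%N -> F k = 0) ->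
  \sum_(k \in [set: nat]) F k = \sum_(k < N) F k.
Proof.
move=> F0; rewrite fsbig_ord; apply/esym/fsbig_widen => //.
by move=> k [_ /= /negP]; rewrite -leqNgt => /F0.
Qed.

Lemma dotE (R : realType) (u v : nat -> R[i]) (N : nat) :
  (forall k, (N <= k)%N -> u k = 0) ->
  dot u v = \sum_(k < N) u k * (v k)^*.
Proof. by move=> u0; apply: fsumT_ord => k /u0->; rewrite mul0r. Qed.

Lemma apply_mxE (R : realType) (A : nat -> nat -> R[i]) (u : nat -> R[i])
    (N : nat) (i : nat) :
  (forall k, (N <= k)%N -> u k = 0) ->
  apply_mx A u i = \sum_(j < N) A i j * u j.
Proof.
by move=> u0; apply: (@fsumT_ord _ (fun j => A i j * u j)) => k /u0->; rewrite mulr0.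
Qed.

Lemma near_tridiagonal_finsupp (R : realType) (J : nat -> nat -> nat -> R[i])
    (n : nat) (u : nat -> R[i]) :
  near_tridiagonal_family J -> (1 <= n)%N -> finsupp u ->
  finsupp (apply_mx (J n) u).
Proof.
move=> [a [b [c [_ JE]]]] n1 [N u0]; exists N.+1 => i Ni.
rewrite (apply_mxE _ _ u0) big1// => j _; rewrite JE// /near_tridiagonal_mx.
have ji : (j.+1 < i)%N by apply: leq_trans Ni; rewrite ltnS.
by rewrite ltnNge (ltnW (ltnW ji)) /= !gtn_eqF ?mul0r// ltnW.
Qed.

Lemma orbit_finsupp (R : realType) (J : nat -> nat -> nat -> R[i]) (j : nat) :
  near_tridiagonal_family J -> finsupp (orbit J j).
Proof.
move=> JP; elim: j => [|j IHj]; last exact: near_tridiagonal_finsupp.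
by exists 1%N => -[].
Qed.

(* Main.v *)
Require Import Defs.
From mathcomp Require Import all_boot all_order all_algebra.
From mathcomp Require Import complex reals.
From mathcomp Require Import ring.

(** A near tridiagonal model is a Cholesky factorization in disguise.  Write
    K i j = \sum_k (U k i)^* * U k j with U upper triangular and positive on
    the diagonal, and let H be the Hessenberg matrix such that H U is U with
    its first column removed.  Column j of J_n is not prescribed by the earlier
    matrices exactly when j = n - 1, so the first n columns of J_n may be taken
    to be those of H.  As column n - 1 of U is supported on [0, n - 1], J_n
    maps it to column n, and the orbit of e_0^* consists of the columns of U. *)

Set Implicit Arguments.
Unset Strict Implicit.
Unset Printing Implicit Defensive.

Import Order.TTheory GRing.Theory Num.Theory.

Local Open Scope ring_scope.

Section TriangularSystem.

Variable F : fieldType.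
Implicit Types (U : nat -> nat -> F) (v : nat -> F).

(** Forward substitution for the row system h U = v with [U] upper triangular: column 0 gives [h0],
    whose contribution is removed from [v] before the first row and column of [U] are dropped. *)
Fixpoint tri_solve U v (n : nat) : F :=
  let h0 := v 0%N / U 0%N 0%N in
  if n is n'.+1 then
    tri_solve (fun i j => U i.+1 j.+1) (fun j => v j.+1 - h0 * U 0%N j.+1) n'
  else h0.

Lemma tri_solveP U v :
  (forall i, U i i != 0) ->
  forall j, \sum_(m < j.+1) tri_solve U v m * U m j = v j.
Proof.
move=> U_neq0 j; elim: j U v U_neq0 => [|j IHj] U v U_neq0.
  by rewrite big_ord1 /= divfK.
by rewrite big_ord_recl /= IHj // subrKC.
Qed.

(** Once the earlier unknowns vanish, equation [j] reduces to h_j * [U j j] = 0. *)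
Lemma tri_solve0 U v n :
  (forall i, U i i != 0) -> (forall j, (j < n)%N -> v j = 0) ->
  forall j, (j < n)%N -> tri_solve U v j = 0.
Proof.
move=> U_neq0 v0 j; elim/ltn_ind: j => j IHj jn.
have := tri_solveP v U_neq0 j; rewrite big_ord_recr big1 /= => [|m _].
  by rewrite add0r v0// => /eqP; rewrite mulf_eq0 (negPf (U_neq0 j)) orbF => /eqP.
by rewrite IHj ?mul0r// (ltn_trans _ jn).
Qed.

End TriangularSystem.

Section Cholesky.

Variable C : numClosedFieldType.
Implicit Types T : nat -> nat -> C.

Definition hermitian T := forall i j, T j i = (T i j)^*.

Definition posdef T := forall n (l : nat -> C),
  (exists2 k, (k < n)%N & l k != 0) ->
  0 < \sum_(i < n) \sum_(j < n) T i j * l j * (l i)^*.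

Definition schur T (i j : nat) : C :=
  T i.+1 j.+1 - T i.+1 0%N * T 0%N j.+1 / T 0%N 0%N.

Lemma posdef_gt0 T : posdef T -> 0 < T 0%N 0%N.
Proof.
move=> /(_ 1%N (fun=> 1)); rewrite !big_ord1 rmorph1 !mulr1; apply.
by exists 0%N; rewrite ?oner_neq0.
Qed.

Lemma schur_hermitian T : hermitian T -> hermitian (schur T).
Proof.
move=> Th i j; rewrite /schur rmorphB !rmorphM fmorphV /= -!Th.
by rewrite [T j.+1 _ * _]mulrC.
Qed.

(* The form of the Schur complement at l is the form of T at (x, l), where x
   is chosen to make row 0 vanish. *)
Lemma schur_posdef T : posdef T -> posdef (schur T).
Proof.
move=> Tpd n l [k kn lk0]; have T00 := lt0r_neq0 (posdef_gt0 Tpd).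
pose x := - (\sum_(j < n) T 0%N j.+1 * l j) / T 0%N 0%N.
have := Tpd n.+1 (fun m => if m is m'.+1 then l m' else x).
rewrite big_ord_recl -mulr_suml big_ord_recl /=.
rewrite [T 0%N 0%N * x]mulrC /x divfK// addNr mul0r add0r -/x.
under eq_bigr => i _.
  rewrite -mulr_suml big_ord_recl /=.
  have -> : T i.+1 0%N * x + \sum_(j < n) T i.+1 j.+1 * l j
      = \sum_(j < n) schur T i j * l j.
    rewrite /x !mulNr mulrN mulr_suml mulr_sumr -sumrN -big_split /=.
    by apply: eq_bigr => j _; rewrite /schur; field.
  rewrite mulr_suml.
  over.
by apply; exists k.+1.
Qed.

Fixpoint cholesky T (k n : nat) : C :=
  match k, n with
  | 0, _ => T 0%N n / sqrtC (T 0%N 0%N)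
  | _.+1, 0 => 0
  | k'.+1, n'.+1 => cholesky (schur T) k' n'
  end.

Lemma cholesky_triangular T k n : (n < k)%N -> cholesky T k n = 0.
Proof. by elim: k T n => [|k IHk] T [|n] //= nk; apply: IHk. Qed.

Lemma cholesky_diag_gt0 T k : posdef T -> 0 < cholesky T k k.
Proof.
elim: k T => [|k IHk] T Tpd /=; last exact/IHk/schur_posdef.
by rewrite divr_gt0 ?sqrtC_gt0 ?posdef_gt0.
Qed.

(** The term [k = 0] is the rank-one matrix that [schur] subtracts; induction on [N] factors the
    rest. Any [N > j] will do, since the rows beyond [j] vanish in column [j]. *)
Lemma choleskyP T i j N : hermitian T -> posdef T -> (j < N)%N ->
  T i j = \sum_(k < N) cholesky T k j * (cholesky T k i)^*.
Proof.
elim: N T i j => [//|N IHN] T i j Th Tpd jN.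
have T00 := posdef_gt0 Tpd; have T00n := lt0r_neq0 T00.
rewrite big_ord_recl /= rmorphM fmorphV /= -Th.
rewrite (CrealP (ger0_real _)) ?sqrtC_ge0 ?ltW//.
rewrite mulrACA -invfM -expr2 sqrtCK.
(* If [i] or [j] is 0, the later rows contribute nothing, as their column 0 is zero. *)
case: j i jN => [|j] [|i] jN /=.
- by rewrite big1 ?addr0 ?mulfK// => k _; rewrite mul0r.
- by rewrite big1 ?addr0 1?mulrC ?mulKf// => k _; rewrite mul0r.
- by rewrite big1 ?addr0 ?mulfK// => k _; rewrite rmorph0 mulr0.
rewrite -(IHN _ i j (schur_hermitian Th) (schur_posdef Tpd) jN) /schur.
by rewrite [T 0%N _ * _]mulrC subrKC.
Qed.

End Cholesky.

Section StrictlyPositiveDefinite.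

Variables (R : realType) (K : nat -> nat -> R[i]).
Hypothesis K_pd : strictly_positive_definite K.

Lemma spd_posdef : posdef K.
Proof.
move=> n l [k kn lk]; apply: (K_pd (p := val) (l := fun i : 'I_n => l i)).
- by rewrite (leq_trans _ kn).
- exact: val_inj.
- by exists (Ordinal kn).
Qed.

Lemma spd_diag_gt0 i : 0 < K i i.
Proof.
have := @K_pd 1 (fun=> i) (fun=> 1); rewrite !big_ord1 rmorph1 !mulr1; apply => //.
  by move=> x y _; rewrite !ord1.
by exists ord0; rewrite oner_neq0.
Qed.

(** These are the cross terms of the form at the points [i], [j] with weights 1, [w]; the whole form
    and its diagonal terms are real. *)
Lemma spd_cross_real i j w : i != j ->
  K i j * w + K j i * w^* \is Num.real.
Proof.
move=> ij.
have := @K_pd 2 (fun k => if k == ord0 then i else j)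
  (fun k => if k == ord0 then 1 else w).
rewrite !big_ord_recl !big_ord0 /= rmorph1 => K2.
have {K2} /gtr0_real K2 : 0 < K i i + (K i j * w + K j i * w^*) + K j j * w * w^*.
  have -> : K i i + (K i j * w + K j i * w^*) + K j j * w * w^*
    = K i i * 1 * 1 + (K i j * w * 1 + 0) +
      (K j i * 1 * w^* + (K j j * w * w^* + 0) + 0) by ring.
  apply: K2 => //; last by exists ord0; rewrite oner_neq0.
  by case=> [[|[|//]] ?] [[|[|//]] ?] //= e; apply/val_inj => //=;
    move: ij; rewrite e eqxx.
have Kjj : K j j * w * w^* \is Num.real.
  by rewrite -mulrA -normCK rpredM ?rpredX ?normr_real// gtr0_real ?spd_diag_gt0.
have Kii := gtr0_real (spd_diag_gt0 i).
have := rpredB (rpredB K2 Kjj) Kii.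
by rewrite addrK [K i i + _]addrC addrK.
Qed.

(** Polarization: the weights [w = 1] and [w = 'i] show that [K i j + K j i] is real and
    [K i j - K j i] purely imaginary. *)
Lemma spd_hermitian : hermitian K.
Proof.
move=> i j; have [<-|ij] := eqVneq i j.
  by rewrite (CrealP (gtr0_real (spd_diag_gt0 i))).
have /CrealP := spd_cross_real 1 ij.
have /CrealP := spd_cross_real 'i ij.
rewrite !rmorphD !rmorphM /= !conjCK conjCi rmorph1 !mulr1 => ei e1.
have {}ei : - (K i j)^* + (K j i)^* = K i j - K j i.
  apply: (mulIf (neq0Ci R[i])); rewrite mulrDl mulrBl mulNr.
  by rewrite -mulrN ei mulrN.
apply: (mulfI (x := 2)); first by rewrite pnatr_eq0.
have -> : 2 * K j i = (K i j + K j i) - (K i j - K j i) by ring.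
by rewrite -ei -e1; ring.
Qed.

End StrictlyPositiveDefinite.

Section HessenbergModel.

Variables (R : realType) (U : nat -> nat -> R[i]).
Hypothesis U_triangular : forall k n, (n < k)%N -> U k n = 0.
Hypothesis U_diag_gt0 : forall k, 0 < U k k.

Let U_diag_neq0 k : U k k != 0.
Proof. exact: lt0r_neq0. Qed.

Definition hessenberg (i : nat) : nat -> R[i] :=
  tri_solve U (fun j => U i j.+1).

(** The right-hand side is row [i] of [U] shifted left by one, so it starts with [i - 1] zeros, and
    forward substitution preserves them. *)
Lemma hessenberg0 i j : (j.+1 < i)%N -> hessenberg i j = 0.
Proof.
case: i => [//|i] ji; apply: (tri_solve0 (n := i)) => // m mi.
exact: U_triangular.
Qed.

(** By [hessenberg0] only the last term of equation [k] survives: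
    [hessenberg k.+1 k * U k k = U k.+1 k.+1]. *)
Lemma hessenberg_subdiag_gt0 k : 0 < hessenberg k.+1 k.
Proof.
have := tri_solveP (fun j => U k.+1 j.+1) U_diag_neq0 k.
rewrite big_ord_recr big1 /= => [|m _]; last first.
  by rewrite -/(hessenberg _ _) hessenberg0 ?mul0r ?ltnS.
rewrite add0r => /(canRL (mulfK (U_diag_neq0 k))) hE.
by rewrite /hessenberg hE divr_gt0.
Qed.

(** From column [n] on, the entries above the diagonal are dictated by the model: the superdiagonal
    mirrors the subdiagonal, and the rest is 0. *)
Definition model_c (n i j : nat) : R[i] :=
  if (j < n)%N then hessenberg i j
  else if i == j.-1 then hessenberg j j.-1 else 0.

Definition model_mx (n i j : nat) : R[i] :=
  near_tridiagonal_mx (fun k => hessenberg k k.-1) (fun k => hessenberg k k)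
    model_c n i j.

Lemma model_mx_family : near_tridiagonal_family model_mx.
Proof.
exists (fun k => hessenberg k k.-1), (fun k => hessenberg k k), model_c.
split=> //; rewrite /model_c; split.
- by case=> // k _; apply: hessenberg_subdiag_gt0.
- by move=> i j j2 ij; rewrite ltnNge (ltnW j2) /= ltn_eqF.
- by move=> n i j _ nj ij; rewrite ltnNge nj /= ltn_eqF.
- by move=> n k _ nk _; rewrite ltnNge nk /= eqxx.
- by move=> [//|n] i j _ /= jn _; rewrite jn (leqW jn).
Qed.

Lemma model_mx_hessenberg n i j : (j < n)%N -> model_mx n i j = hessenberg i j.
Proof.
move=> jn; rewrite /model_mx /near_tridiagonal_mx /model_c jn.
case: ltngtP => [//|ji|->//]; case: eqVneq => [->//|ij].
by rewrite hessenberg0// ltn_neqAle eq_sym ij.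
Qed.

Hypothesis U00 : U 0%N 0%N = 1.

Lemma orbit_model_mx n k : Defs.orbit model_mx n k = U k n.
Proof.
elim: n k => [|n IHn] k /=.
  (* The normalization [U00] makes column 0 of [U] equal to the starting vector. *)
  by case: k => [|k]; rewrite /basis0 ?U00// U_triangular.
have supp m : (n < m)%N -> Defs.orbit model_mx n m = 0.
  by move=> nm; rewrite IHn U_triangular.
rewrite (apply_mxE _ _ supp).
rewrite -(tri_solveP (fun j => U k j.+1) U_diag_neq0 n).
by apply: eq_bigr => j _; rewrite IHn model_mx_hessenberg.
Qed.

End HessenbergModel.

Theorem theorem3p2 (R : realType) (K : nat -> nat -> R[i])
    (K_pd : strictly_positive_definite K) (K00 : K 0%N 0%N = 1) :
  exists J : nat -> nat -> nat -> R[i], near_tridiagonal_model K J.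
Proof.
have Kpd := spd_posdef K_pd; have Kh := spd_hermitian K_pd.
have U_tri := @cholesky_triangular _ K.
have U_gt0 k := cholesky_diag_gt0 k Kpd.
have U00 : cholesky K 0 0 = 1 by rewrite /= K00 sqrtC1 divr1.
exists (model_mx (cholesky K)); split=> [|i j]; first exact: model_mx_family.
have supp k : (j < k)%N -> Defs.orbit (model_mx (cholesky K)) j k = 0.
  by move=> jk; rewrite orbit_model_mx // U_tri.
rewrite (dotE _ supp) (choleskyP i Kh Kpd (ltnSn j)).
by apply: eq_bigr => k _; rewrite !orbit_model_mx.
Qed.
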